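(* The generalized SUQR parametric hypothesis class $\mathcal{H}$ is $(\alpha,\delta)$-PAC learnable with sample complexity $$O\Big(\frac1{\alpha^2}\big(\log\frac1\delta+T\log\frac T\alpha\big)\Big).$$ That is, there is a constant $C$ depending only on $M$ such that for all $T\ge2$, all integers $1\le K<T$, and all $\alpha,\delta\in(0,1)$, the class $\mathcal{H}$ is $(\alpha,\delta)$-PAC learnable with $m$ samples whenever $m\ge \frac{C}{\alpha^2}\big(\log\frac1\delta+T\log\frac T\alpha\big)$.
   Context: Setting. $T$ is the number of targets, $K$ the number of defender resources, $X=\{x\in[0,1]^T:\sum_{i=1}^T x_i\le K\}$, $Y=\{\mathrm{t}_1,\dots,\mathrm{t}_T\}$ with $\mathrm{t}_i$ the $i$-th unit vector of $\mathbb{R}^T$ (attack on target $i$), $Z=X\times Y$, and $M>1$ is a fixed constant. Generalized SUQR class. $\mathcal{H}$ consists of all functions $h=\langle h_1,\dots,h_{T-1}\rangle:X\to[-\frac M2,\frac M2]^{T-1}$ of the form $h_i(x)=w_1(x_i-x_T)+c_{iT}$, where the weight $w_1\in\mathbb{R}$ is common to all components and $c_{1T},\dots,c_{T-1\,T}\in\mathbb{R}$; it is assumed that each of the functions $x\mapsto w_1(x_i-x_T)$ and each constant $c_{iT}$ has range in $[-\frac M4,\frac M4]$ (so $w_1,c_{iT}\in[-\frac M4,\frac M4]$). Loss and risks. $l(\mathrm{t}_i,a)=-\log\frac{e^{a_i}}{1+\sum_{j=1}^{T-1}e^{a_j}}$ for $a\in\mathbb{R}^{T-1}$, with $a_T:=0$.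 For a distribution $p$ on $Z$, $r_h(p)=E_{(x,y)\sim p}[l(y,h(x))]$; for $\vec z=((x_1,y_1),\dots,(x_m,y_m))$, $\hat r_h(\vec z)=\frac1m\sum_{i=1}^m l(y_i,h(x_i))$. PAC learnability. $\mathcal{H}$ is $(\alpha,\delta)$-PAC learnable with $m$ samples if there is an algorithm $\mathcal{A}$ mapping samples to hypotheses in $\mathcal{H}$ such that for every distribution $p$ on $Z$ and $\vec z$ consisting of $m$ i.i.d. draws from $p$: (i) $Pr(\forall h\in\mathcal{H}:|\hat r_h(\vec z)-r_h(p)|<\alpha/3)>1-\delta/2$, and (ii) $Pr(|\hat r_{\mathcal{A}(\vec z)}(\vec z)-\inf_{h\in\mathcal{H}}\hat r_h(\vec z)|<\alpha/3)>1-\delta/2$. (These imply $Pr(|r_{\mathcal{A}(\vec z)}(p)-\inf_{h\in\mathcal{H}}r_h(p)|<\alpha)>1-\delta$.) *)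

(* Defs.v *)
From HB Require Import structures.
From mathcomp Require Import all_boot all_order all_algebra.
From mathcomp Require Import all_classical all_reals all_analysis.

Set Implicit Arguments.
Unset Strict Implicit.
Unset Printing Implicit Defensive.

Import Order.TTheory GRing.Theory Num.Theory.
Import numFieldNormedType.Exports.

Local Open Scope classical_set_scope.
Local Open Scope ring_scope.

(* The number of targets is T = n.+1. Target i < T is [lift ord_max i] with
   i : 'I_n, and the last target T is [ord_max : 'I_n.+1]. Vectors of R^k are
   k-tuples, which carry the product sigma-algebra. *)

Section Game.
Context {R : realType}.

Definition strategies (n K : nat) : set (n.+1.-tuple R) :=
  [set x | (forall i, 0 <= tnth x i <= 1) /\ \sum_(i < n.+1) tnth x i <= K%:R].

Definition target (n : nat) (i : 'I_n.+1) : n.+1.-tuple R :=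
  [tuple (i == j)%:R | j < n.+1].

Definition attacks (n : nat) : set (n.+1.-tuple R) := range (@target n).

(* Z = X x Y is a subset of R^T x R^T; a distribution on Z is a probability
   measure on R^T x R^T giving mass 1 to [obs_set K]. *)
Definition obs (n : nat) : Type := (n.+1.-tuple R * n.+1.-tuple R)%type.

Definition obs_set (n K : nat) : set (obs n) :=
  strategies K `*` attacks (n := n).

Definition hypothesis (n : nat) : Type := n.+1.-tuple R -> n.-tuple R.

(* A hypothesis is determined by its restriction to [strategies K]; it is
   extended to R^T by the same formula. *)
Definition suqr (M : R) (n K : nat) : set (hypothesis n) :=
  [set h | (forall x, strategies K x ->
              forall i : 'I_n, - (M / 2) <= tnth (h x) i <= M / 2) /\
    exists (w1 : R) (c : 'I_n -> R),
      [/\ forall (i : 'I_n) x, strategies K x ->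
            - (M / 4) <= w1 * (tnth x (lift ord_max i) - tnth x ord_max)
                      <= M / 4,
          forall i, - (M / 4) <= c i <= M / 4 &
          forall x (i : 'I_n), tnth (h x) i =
            w1 * (tnth x (lift ord_max i) - tnth x ord_max) + c i] ].

(* a_i for i < T, and a_T = 0. *)
Definition score (n : nat) (a : n.-tuple R) (i : 'I_n.+1) : R :=
  if unlift ord_max i is Some j then tnth a j else 0.

(* Only meaningful at y \in Y; the sum selects the i such that y = t_i, see
   [loss_target]. *)
Definition loss (n : nat) (y : n.+1.-tuple R) (a : n.-tuple R) : R :=
  \sum_(i < n.+1 | y == target i)
    - ln (expR (score a i) / (1 + \sum_(j < n) expR (tnth a j))).

Lemma target_inj (n : nat) : injective (@target n).
Proof.
move=> i j /(congr1 (fun t => tnth t i)); rewrite !tnth_mktuple eqxx.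
by case: eqVneq => // _ /eqP; rewrite oner_eq0.
Qed.

Lemma loss_target (n : nat) (i : 'I_n.+1) (a : n.-tuple R) :
  loss (target i) a =
  - ln (expR (score a i) / (1 + \sum_(j < n) expR (tnth a j))).
Proof.
by rewrite /loss (big_pred1 i) // => j; rewrite (inj_eq (@target_inj n)) eq_sym.
Qed.

(* For h in [suqr M n K] the loss is bounded on Z, so the expectation is finite
   and [fine] loses nothing. *)
Definition risk (n : nat) (p : probability (obs n) R) (h : hypothesis n) : R :=
  fine 'E_p[fun z : obs n => loss z.2 (h z.1)].

Definition empirical_risk (n m : nat) (z : m.-tuple (obs n))
    (h : hypothesis n) : R :=
  m%:R^-1 * \sum_(i < m) loss (tnth z i).2 (h (tnth z i).1).

(* The components of z are mutually independent with common law p. *)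
Definition iid_draws d (Omega : measurableType d) (P : probability Omega R)
    (n m : nat) (p : probability (obs n) R)
    (z : Omega -> m.-tuple (obs n)) : Prop :=
  [/\ measurable_fun [set: Omega] z,
      forall (i : 'I_m) (B : set (obs n)), measurable B ->
        P [set w | B (tnth (z w) i)] = p B &
      forall (J : {set 'I_m}) (B : 'I_m -> set (obs n)),
        (forall i, measurable (B i)) ->
        P [set w | forall i, i \in J -> B i (tnth (z w) i)] =
        (\prod_(i in J) P [set w | B i (tnth (z w) i)])%E].

(* A measure takes arbitrary values on non-measurable sets, so that the
   measurability of the event is part of the claim. *)
Definition Pr_gt d (Omega : measurableType d) (P : probability Omega R)
    (E : set Omega) (r : R) : Prop :=
  measurable E /\ (r%:E < P E)%E.

(* The i.i.d. sample is a random vector on an arbitrary probability space, with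
   values in Z^m; the algorithm is chosen before p and before that space. *)
Definition PAC_learnable (n K : nat) (H : set (hypothesis n)) (alpha delta : R)
    (m : nat) : Prop :=
  exists A : m.-tuple (obs n) -> hypothesis n,
    (forall s, H (A s)) /\
    forall p : probability (obs n) R, p (obs_set K) = 1%E ->
    forall d (Omega : measurableType d) (P : probability Omega R)
      (z : Omega -> m.-tuple (obs n)),
      (forall w i, obs_set K (tnth (z w) i)) ->
      iid_draws P p z ->
      Pr_gt P [set w | forall h, H h ->
                 `|empirical_risk (z w) h - risk p h| < alpha / 3]
        (1 - delta / 2) /\
      Pr_gt P [set w |
                 `|empirical_risk (z w) (A (z w))
                   - inf [set empirical_risk (z w) h | h in H]| < alpha / 3]
        (1 - delta / 2).

End Game.

Arguments suqr {R} M n K _.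

(* Main.v *)
(* The loss of attack i under the scores a is ln (1 + sum_j e^(a_j)) - a_i, which
   is 2-Lipschitz in a for the sup norm and equals ln T at a = 0; hence the
   losses of the class lie within M of ln T, an interval whose length does not
   depend on T. Hypotheses are parametrised by the box [-M/4, M/4]^T. At each
   point of a grid of step of order alpha the deviation of the empirical risk
   from the risk is controlled by a Hoeffding bound, and a union bound over the
   (O(M / alpha))^T grid points, together with the Lipschitz estimate, gives
   uniform convergence; the logarithm of the size of the grid is the term
   T ln (T / alpha). The algorithm is approximate empirical risk minimisation,
   so that its requirement holds surely. *)
Require Import Defs.
From HB Require Import structures.
From mathcomp Require Import all_boot all_order all_algebra.
From mathcomp Require Import all_classical all_reals all_analysis.
From mathcomp Require Import measurable_realfun.
From mathcomp Require Import ring lra.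
Import Order.TTheory GRing.Theory Num.Theory.
Import numFieldNormedType.Exports.
Local Open Scope classical_set_scope.
Local Open Scope ring_scope.
Set Implicit Arguments.
Unset Strict Implicit.
Unset Printing Implicit Defensive.

(** * Hoeffding's inequality *)

(** Since [expR (- y) >= 1 - y > 0], [expR y] is at most [1 / (1 - y)], and the right-hand side
    times [1 - y] exceeds 1 by [y ^+ 2 * (1 - 2 * y)]. *)
Lemma expR_le_quadratic (R : realType) (y : R) :
  y <= 2^-1 -> expR y <= 1 + y + 2 * y ^+ 2.
Proof.
move=> hy; have y1 : 0 < 1 - y by lra.
apply: (@le_trans _ _ (1 - y)^-1).
  by rewrite -[X in expR X]opprK expRN lef_pV2 ?posrE ?expR_gt0 ?expR_ge1Dx.
rewrite -[leLHS]mul1r ler_pdivrMr // -subr_ge0.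
have -> : (1 + y + 2 * y ^+ 2) * (1 - y) - 1 = y ^+ 2 * (1 - 2 * y) by ring.
by rewrite mulr_ge0 ?sqr_ge0 //; lra.
Qed.

Section FiniteHoeffding.
Variables (R : realType) (I : finType) (q u : I -> R) (W : R).
Hypothesis q_ge0 : forall i, 0 <= q i.
Hypothesis q_sum1 : \sum_i q i = 1.
Hypothesis u_mean0 : \sum_i q i * u i = 0.
Hypothesis W_gt0 : 0 < W.
Hypothesis u_le : forall i, `|u i| <= W.

(** In the quadratic bound for each [expR (l * u i)] the linear terms average to 0; what remains is
    absorbed by [1 + x <= expR x]. *)
Lemma mgf_le (l : R) : 0 <= l -> l * W <= 2^-1 ->
  \sum_i q i * expR (l * u i) <= expR (2 * (l * W) ^+ 2).
Proof.
move=> l0 lW; apply: le_trans (expR_ge1Dx _).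
have -> : 1 + 2 * (l * W) ^+ 2 =
    \sum_i q i * (1 + l * u i + 2 * (l * W) ^+ 2).
  under eq_bigr do rewrite !mulrDr mulr1 mulrCA.
  by rewrite !big_split /= -mulr_sumr u_mean0 -mulr_suml q_sum1 mulr0 addr0 mul1r.
apply: ler_sum => i _; apply: ler_wpM2l => //.
have := u_le i; rewrite ler_norml => /andP[h1 h2].
apply: le_trans (expR_le_quadratic _) _.
  by apply: le_trans lW; exact: ler_wpM2l.
rewrite lerD2l ler_pM2l // -[leLHS]real_normK ?num_real // lerXn2r ?nnegrE //.
  by rewrite mulr_ge0 // ltW.
by rewrite normrM (ger0_norm l0) ler_wpM2l.
Qed.

(* Chernoff's method with the parameter [t / (4 W^2)]. *)
Lemma finite_hoeffding (m : nat) (t : R) : 0 < t <= 2 * W ->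
  \sum_(b : {ffun 'I_m -> I} | m%:R * t <= \sum_j u (b j)) \prod_j q (b j)
  <= expR (- (m%:R * t ^+ 2 / (8 * W ^+ 2))).
Proof.
move=> /andP[t0 tW]; pose l := t / (4 * W ^+ 2).
have W20 : 0 < W ^+ 2 by rewrite exprn_gt0.
have l0 : 0 <= l by rewrite divr_ge0 // ltW // mulr_gt0.
have lW : l * W <= 2^-1.
  have -> : l * W = t / (4 * W) by rewrite /l; field; rewrite gt_eqF.
  by rewrite ler_pdivrMr ?mulr_gt0 //; lra.
(* Markov's inequality term by term: on the bad words [expR (l * (\sum_j u (b j) - m%:R * t))] is at
   least 1. *)
have step (b : {ffun 'I_m -> I}) : m%:R * t <= \sum_j u (b j) ->
    \prod_j q (b j) <=
    expR (- (l * (m%:R * t))) * \prod_j (q (b j) * expR (l * u (b j))).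
  move=> hb; rewrite big_split /= -expR_sum -mulr_sumr mulrCA -expRD.
  rewrite ler_peMr ?prodr_ge0 // -[X in X <= _]expR0 ler_expR addrC subr_ge0.
  exact: ler_wpM2l.
apply: (le_trans (ler_sum _ step)).
have ge0 (b : {ffun 'I_m -> I}) :
    0 <= expR (- (l * (m%:R * t))) * \prod_j (q (b j) * expR (l * u (b j))).
  by rewrite mulr_ge0 ?expR_ge0 // prodr_ge0 // => j _; rewrite mulr_ge0 ?expR_ge0.
rewrite big_mkcond /=.
apply: (@le_trans _ _ (\sum_(b : {ffun 'I_m -> I})
    expR (- (l * (m%:R * t))) * \prod_j (q (b j) * expR (l * u (b j))))).
  by apply: ler_sum => b _; case: ifP => _; rewrite ?ge0.
(* Independence: the sum over words of products is the [m]-th power of a single moment generating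
   function. *)
rewrite -mulr_sumr -(bigA_distr_bigA (fun=> fun i => q i * expR (l * u i))) /=.
rewrite prodr_const card_ord.
have h : (\sum_i q i * expR (l * u i)) ^+ m <= expR (2 * (l * W) ^+ 2) ^+ m.
  rewrite lerXn2r ?nnegrE ?expR_ge0 ?mgf_le // sumr_ge0 // => i _.
  by rewrite mulr_ge0 ?expR_ge0.
apply: (le_trans (ler_wpM2l (expR_ge0 _) h)).
rewrite -expRM_natl -expRD ler_expR le_eqVlt; apply/orP; left; apply/eqP.
by rewrite /l -mulr_natl; field; rewrite gt_eqF.
Qed.

End FiniteHoeffding.

Lemma measure_le_sum d (T : measurableType d) (R : realType)
    (mu : {measure set T -> \bar R}) (I : finType) (P : pred I)
    (F : I -> set T) (A : set T) :
  (forall i, P i -> measurable (F i)) -> measurable A ->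
  A `<=` \bigcup_(i in [set i | P i]) F i ->
  (mu A <= \sum_(i | P i) mu (F i))%E.
Proof.
move=> mF mA AF.
have fP : finite_set [set i | P i] by apply: finite_finset.
apply: (le_trans (content_sub_fsum mu fP mF mA AF)).
by rewrite [leRHS]bigfs ?index_enum_uniq // => i _; rewrite mem_index_enum.
Qed.

(** * Integrals of bounded and finite-valued functions over a set of full measure *)

Section BoundedOnFullSet.
Context d (T : measurableType d) (R : realType) (p : probability T R).
Variable A : set T.
Hypothesis mA : measurable A.
Hypothesis pA : p A = 1%E.

Lemma measurable_bounded_on_integrable (f : T -> R) (W : R) :
  measurable_fun A f -> (forall z, A z -> `|f z| <= W) ->
  p.-integrable A (EFin \o f).
Proof.
move=> mf fW; apply: measurable_bounded_integrable => //.
- by have : (p A < +oo)%E by rewrite pA ltry.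
- exists W; split; first exact: num_real.
  by move=> x Wx z /fW /= fz; exact: le_trans fz (ltW Wx).
Qed.

(** The complement of [A] is null. This moves the risk to an integral over Z, where the bounds on
    the loss are available. *)
Lemma expectation_on_full_set (f : T -> R) : measurable_fun setT f ->
  fine 'E_p[f] = \int[p]_(z in A) f z.
Proof.
move=> mf; rewrite unlock /Rintegral [in RHS]integral_mkcond; congr fine.
have /measurable_EFinP mf' := mf.
apply: ae_eq_integral => //.
  by apply/measurable_restrict => //; exact: measurable_funTS.
have pAc : p (~` A) = 0%E by rewrite probability_setC // pA subee.
exists (~` A); split => //; first exact: measurableC.
move=> z /= h Az; apply: h => _; rewrite patchE mem_set //.
Qed.

Lemma Rintegral_close (f g : T -> R) (c : R) :
  p.-integrable A (EFin \o f) -> p.-integrable A (EFin \o g) ->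
  (forall z, A z -> `|f z - g z| <= c) ->
  `|\int[p]_(z in A) f z - \int[p]_(z in A) g z| <= c.
Proof.
move=> fi gi fg; rewrite -RintegralB //.
have fgi : p.-integrable A (EFin \o (fun z => f z - g z)).
  have -> : EFin \o (fun z => f z - g z) = ((EFin \o f) \- (EFin \o g))%E.
    by apply/funext => z /=; rewrite EFinB.
  exact: integrableB.
apply: (le_trans (le_normr_Rintegral mA fgi)).
have /= := Rintegral_cst p mA c; rewrite pA mulr1 => <-.
apply: le_Rintegral => //; first exact: integrable_norm.
by apply: finite_measure_integrable_cst.
Qed.

Section FiniteValued.
Variables (I : finType) (b : T -> I).
Hypothesis mb : forall k, measurable (A `&` b @^-1` [set k]).

Lemma measurable_finite_valued (v : I -> R) : measurable_fun A (v \o b).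
Proof.
move=> _ Y mY.
have -> : A `&` (v \o b) @^-1` Y =
    \bigcup_(k in [set k | Y (v k)]) (A `&` b @^-1` [set k]).
  apply/seteqP; split=> [z [Az Yz]|z [k /= Yk [Az bz]]]; first by exists (b z).
  by split=> //=; rewrite bz.
by apply: fin_bigcup_measurable => [|k _]; [exact: finite_finset | exact: mb].
Qed.

Lemma integrable_finite_valued (v : I -> R) :
  p.-integrable A (EFin \o (v \o b)).
Proof.
apply: (@measurable_bounded_on_integrable _ (\sum_k `|v k|)).
  exact: measurable_finite_valued.
by move=> z _ /=; rewrite (bigD1 (b z)) //= lerDl sumr_ge0.
Qed.

(** On [A] the integrand is a finite combination of indicators of the level sets of [b]; their
    masses become the weights of the finite Hoeffding bound. *)
Lemma Rintegral_finite_valued (v : I -> R) :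
  \int[p]_(z in A) v (b z) =
  \sum_k fine (p (A `&` b @^-1` [set k])) * v k.
Proof.
rewrite /Rintegral.
pose F k := fun z => ((v k)%:E * (\1_(A `&` b @^-1` [set k]) z)%:E)%E.
have iF k : p.-integrable A (fun z => (\1_(A `&` b @^-1` [set k]) z)%:E).
  by apply: integrableS (integrable_indic p (mb k)).
transitivity (fine (\int[p]_(z in A) \sum_k F k z)%E).
  congr fine; apply: eq_integral => z; rewrite inE => Az.
  rewrite (bigD1 (b z)) //= big1 ?adde0 => [|k kb]; rewrite /F indicE.
    by rewrite mem_set ?mule1 //.
  by rewrite memNset ?mule0 // => -[_ /= bz]; rewrite bz eqxx in kb.
rewrite integral_sum // => [|k]; last exact: integrableZl.
under eq_bigr => k _.
  rewrite integralZl // integral_indic // setIAC setIid.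
  over.
rewrite -[RHS]/(fine (_%:E)) -sumEFin; congr fine; apply: eq_bigr => k _.
by rewrite EFinM fineK ?fin_num_measure // muleC.
Qed.

End FiniteValued.
End BoundedOnFullSet.

(** * Hoeffding's inequality for i.i.d. draws *)

Section IidHoeffding.
Context d (T : measurableType d) (R : realType) (p : probability T R).
Variable A : set T.
Hypothesis mA : measurable A.
Hypothesis pA : p A = 1%E.
Context d' (Omega : measurableType d') (P : probability Omega R).
Variables (m : nat) (X : 'I_m -> Omega -> T).
Hypothesis XA : forall i w, A (X i w).
Hypothesis mX : forall i, measurable_fun setT (X i).
Hypothesis iidX : forall B : 'I_m -> set T, (forall i, measurable (B i)) ->
  P [set w | forall i, B i (X i w)] = (\prod_i p (B i))%E.

(** The event is a finite union of cylinders, one for each bad word of classes, and a cylinder has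
    the product of the class masses as its probability. *)
Lemma hoeffding_finite_valued (I : finType) (b : T -> I) (v : I -> R)
    (c W t : R) :
  (forall k, measurable (A `&` b @^-1` [set k])) ->
  0 < W -> (forall k, `|v k - c| <= W) -> 0 < t <= 4 * W ->
  let E := [set w | m%:R * t <=
              \sum_j (v (b (X j w)) - \int[p]_(z in A) v (b z))] in
  measurable E /\ (P E <= (expR (- (m%:R * t ^+ 2 / (32 * W ^+ 2))))%:E)%E.
Proof.
move=> mb W0 vW tW; set mu := \int[p]_(z in A) v (b z) => E.
pose B k := A `&` b @^-1` [set k].
pose q k := fine (p (B k)).
have q0 k : 0 <= q k by apply: fine_ge0.
have q1 : \sum_k q k = 1.
  have := Rintegral_finite_valued p mA mb (fun=> 1).
  have /= -> := Rintegral_cst p mA 1; rewrite pA mulr1 => ->.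
  by apply: eq_bigr => k _; rewrite mulr1.
have muE : mu = \sum_k q k * v k by exact: Rintegral_finite_valued.
have u0 : \sum_k q k * (v k - mu) = 0.
  under eq_bigr do rewrite mulrBr.
  by rewrite sumrB -muE -mulr_suml q1 mul1r subrr.
(* The mean also lies within [W] of [c], so centring at it doubles the bound; hence the constant 32,
   which is 8 times 4. *)
have uW k : `|v k - mu| <= 2 * W.
  have cmu : `|c - mu| <= W.
    have -> : c - mu = \sum_k q k * (c - v k).
      under eq_bigr do rewrite mulrBr.
      by rewrite sumrB -muE -mulr_suml q1 mul1r.
    apply: (le_trans (ler_norm_sum _ _ _)).
    rewrite -[leRHS]mul1r -q1 mulr_suml; apply: ler_sum => i _.
    by rewrite normrM (ger0_norm (q0 i)) ler_wpM2l // distrC.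
  rewrite (_ : v k - mu = (v k - c) + (c - mu)); last by ring.
  by apply: (le_trans (ler_normD _ _)); have := vW k; lra.
pose bad (f : {ffun 'I_m -> I}) := m%:R * t <= \sum_j (v (f j) - mu).
pose F (f : {ffun 'I_m -> I}) := [set w | forall j, B (f j) (X j w)].
have mF f : measurable (F f).
  have -> : F f = \bigcap_(j in [set: 'I_m]) (X j @^-1` (B (f j))).
    by apply/seteqP; split=> [w h j _|w h j]; exact: h.
  apply: fin_bigcap_measurable => [|j _]; first exact: (@finite_finset 'I_m).
  by rewrite -[X in measurable X]setTI; apply: mX => //; exact: mb.
have EF : E = \bigcup_(f in [set f | bad f]) F f.
  apply/seteqP; split=> [w Ew|w [f /= badf Ff]].
    exists [ffun j => b (X j w)] => /=.
      by rewrite /bad; under eq_bigr do rewrite ffunE.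
    by move=> j; rewrite ffunE; split=> //; exact: XA.
  rewrite /E /= (eq_bigr (fun j => v (f j) - mu)) // => j _.
  by have [_ /= ->] := Ff j.
have mE : measurable E.
  by rewrite EF; apply: fin_bigcup_measurable.
split=> //; apply: (@le_trans _ _ (\sum_(f | bad f) P (F f))%E).
  by apply: measure_le_sum => //; rewrite EF.
have PF f : P (F f) = (\prod_j q (f j))%:E.
  transitivity (\prod_j p (B (f j)))%E; first exact: (iidX (fun j => mb (f j))).
  rewrite -prodEFin; apply: eq_bigr => j _.
  by rewrite fineK //; apply: fin_num_measure; exact: mb.
rewrite (eq_bigr (fun f : {ffun 'I_m -> I} => (\prod_j q (f j))%:E)) //.
rewrite sumEFin lee_fin (_ : 32 * W ^+ 2 = 8 * (2 * W) ^+ 2); last by ring.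
apply: (finite_hoeffding q0 q1 u0 _ uW); first by rewrite mulr_gt0.
by rewrite mulrA (_ : 2 * 2 = 4) //; ring.
Qed.

(* A bounded variable is rounded down to a multiple of [t / 4], so that the
   finite-valued bound applies to both tails at the level [t / 2]. *)
Lemma hoeffding (f : T -> R) (c W t : R) : (0 < m)%N ->
  measurable_fun setT f -> (forall z, A z -> `|f z - c| <= W) ->
  0 < W -> 0 < t <= 8 * W ->
  let E := [set w | t <=
      `|m%:R^-1 * \sum_j f (X j w) - \int[p]_(z in A) f z|] in
  measurable E /\
  (P E <= (2 * expR (- (m%:R * t ^+ 2 / (128 * W ^+ 2))))%:E)%E.
Proof.
move=> m0 mf fW W0 /andP[t0 tW]; set mu := \int[p]_(z in A) f z => E.
have mE : measurable E.
  have mh : measurable_fun setT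
      (fun w => `|m%:R^-1 * \sum_j f (X j w) - mu|).
    apply: measurableT_comp => //; apply: measurable_funB => //.
    apply: measurable_funM => //; apply: measurable_sum => j.
    exact: measurableT_comp (mX j).
  have -> : E = setT `&` (fun w => `|m%:R^-1 * \sum_j f (X j w) - mu|)
                         @^-1` `[t, +oo[.
    by apply/seteqP; split=> w; rewrite /E /= in_itv /= andbT => // -[].
  exact: mh.
split=> //.
pose s := t / 4; have s0 : 0 < s by rewrite divr_gt0.
pose N := Num.truncn (2 * W / s).
pose y z := (f z - (c - W)) / s.
(* The cell of width [s] that contains [f z], counted from [c - W]. Outside [A] the index may
   overflow and [inord] returns its default, so [b] is only studied inside [A]. *)
pose b z : 'I_N.+1 := inord (Num.truncn (y z)).
pose v (k : 'I_N.+1) := c - W + k%:R * s.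
have y0 z : A z -> 0 <= y z.
  by move=> /fW; rewrite ler_norml => /andP[h _]; rewrite divr_ge0 ?(ltW s0) //;
     lra.
have bE z : A z -> b z = Num.truncn (y z) :> nat.
  move=> Az; rewrite inordK // ltnS; apply: le_truncn.
  rewrite ler_pM2r ?invr_gt0 //.
  by have := fW _ Az; rewrite ler_norml => /andP[_ h]; lra.
have mb k : measurable (A `&` b @^-1` [set k]).
  have -> : A `&` b @^-1` [set k] =
      A `&` (setT `&` f @^-1` `[c - W + k%:R * s, c - W + k.+1%:R * s[%classic).
    suff h z : A z -> (b z == k) =
        (f z \in `[c - W + k%:R * s, c - W + k.+1%:R * s[).
      apply/seteqP; split=> z [Az /=].
        by move=> bz; split=> //; split=> //=; rewrite -h // bz.
      by move=> [_ /= fz]; split=> //=; apply/eqP; rewrite h.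
    move=> Az; rewrite -val_eqE /= bE // truncn_eq ?y0 // in_itv /=.
    by rewrite ler_pdivlMr // ltr_pdivrMr // lerBrDl ltrBlDl.
  by apply: measurableI => //; exact: mf.
have vW k : `|v k - c| <= W.
  have kN : k%:R * s <= 2 * W.
    rewrite -ler_pdivlMr // -truncn_ge_nat -1?ltnS //.
    by rewrite divr_ge0 // ?mulr_ge0 // ltW.
  have : 0 <= k%:R * s by rewrite mulr_ge0 // ltW.
  by rewrite /v ler_norml; lra.
have fv z : A z -> `|f z - v (b z)| <= s.
  move=> Az; have := truncn_itv (y0 _ Az).
  rewrite -bE // ler_pdivlMr // ltr_pdivrMr // -natr1 mulrDl mul1r.
  rewrite /v => /andP[h1 h2].
  by rewrite ler_norml; lra.
have ifA : p.-integrable A (EFin \o f).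
  apply: (measurable_bounded_on_integrable mA pA (W := `|c| + W)).
    exact: measurable_funTS.
  move=> z /fW h; rewrite -[f z](subrK c) addrC.
  by apply: (le_trans (ler_normD _ _)); rewrite lerD2l.
pose nu := \int[p]_(z in A) v (b z).
have munu : `|mu - nu| <= s.
  by apply: Rintegral_close => //; exact: integrable_finite_valued.
have t2 : 0 < t / 2 <= 4 * W by lra.
have := hoeffding_finite_valued mb W0 vW t2.
set E1 := [set _ | _] => -[mE1 PE1].
have vW' k : `|- v k - - c| <= W by rewrite -opprD normrN.
have := hoeffding_finite_valued (v := fun k => - v k) mb W0 vW' t2.
set E2 := [set _ | _] => -[mE2 PE2].
(* Rounding moves each value and the mean by at most [t / 4], so a deviation [t] leaves at least
   [t / 2]; [E2] is the lower tail, treated as the upper tail of [- v]. *)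
have EE : E `<=` E1 `|` E2.
  move=> w; rewrite /E /E1 /E2 /= => h.
  have nuN : \int[p]_(z in A) - v (b z) = - nu.
    rewrite /nu (Rintegral_finite_valued p mA mb (fun k => - v k)).
    rewrite (Rintegral_finite_valued p mA mb v) -sumrN.
    by apply: eq_bigr => k _; rewrite mulrN.
  rewrite nuN -/nu.
  have mR : 0 < m%:R :> R by rewrite ltr0n.
  have h1 : m%:R * t <= `|\sum_j (f (X j w) - mu)|.
    rewrite sumrB sumr_const card_ord -(mulr_natl mu).
    have -> : \sum_j f (X j w) - m%:R * mu =
        m%:R * (m%:R^-1 * \sum_j f (X j w) - mu).
      by rewrite mulrBr mulrA divff ?mul1r // gt_eqF.
    by rewrite normrM (gtr0_norm mR) ler_pM2l.
  have h2 : `|\sum_j (f (X j w) - mu) - \sum_j (v (b (X j w)) - nu)|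
      <= m%:R * (t / 2).
    rewrite -sumrB; apply: (le_trans (ler_norm_sum _ _ _)).
    rewrite mulr_natl -[X in _ *+ X](card_ord m) -sumr_const.
    apply: ler_sum => j _.
    have -> : f (X j w) - mu - (v (b (X j w)) - nu) =
        (f (X j w) - v (b (X j w))) - (mu - nu) by ring.
    apply: (le_trans (ler_normB _ _)).
    by have := fv _ (XA j w); move: munu; rewrite /s; lra.
  have h3 : m%:R * (t / 2) <= `|\sum_j (v (b (X j w)) - nu)|.
    have := ler_distD (\sum_j (f (X j w) - mu)) (\sum_j (v (b (X j w)) - nu)) 0.
    have := ler_distD (\sum_j (v (b (X j w)) - nu)) (\sum_j (f (X j w) - mu)) 0.
    by rewrite !subr0 => + _; lra.
  move: h3; rewrite ler_normr => /orP[h3|h3]; [by left|right].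
  apply: (le_trans h3); rewrite -sumrN le_eqVlt; apply/orP; left.
  by apply/eqP; apply: eq_bigr => j _; ring.
apply: (@le_trans _ _ (P (E1 `|` E2))).
  by apply: le_measure => //; rewrite inE //; exact: measurableU.
apply: (le_trans (measureU2 P mE1 mE2)).
have -> : m%:R * t ^+ 2 / (128 * W ^+ 2) = m%:R * (t / 2) ^+ 2 / (32 * W ^+ 2).
  by field; rewrite gt_eqF.
by rewrite mulr2n mulrDl mul1r EFinD leeD.
Qed.

End IidHoeffding.

(** * The SUQR class *)

Section Suqr.
Context {R : realType}.

(** The last entry of [th] is the common weight and the others are the constants, so the class has
    exactly T real parameters. *)
Definition suqr_param (n : nat) (th : 'rV[R]_n.+1) : hypothesis n :=
  fun x => [tuple th ord0 ord_max * (tnth x (lift ord_max i) - tnth x ord_max)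
                  + th ord0 (lift ord_max i) | i < n].

Definition box (k : nat) (r : R) : set 'rV[R]_k :=
  [set th | forall i, `|th ord0 i| <= r].

Lemma tnth_suqr_param n (th : 'rV[R]_n.+1) x i :
  tnth (suqr_param th x) i =
  th ord0 ord_max * (tnth x (lift ord_max i) - tnth x ord_max)
  + th ord0 (lift ord_max i).
Proof. by rewrite tnth_mktuple. Qed.

Lemma strategies_diff_le1 n K (x : n.+1.-tuple R) i j :
  strategies K x -> `|tnth x i - tnth x j| <= 1.
Proof.
by move=> [x01 _]; have := x01 i; have := x01 j; rewrite ler_norml; lra.
Qed.

Lemma target_strategy n K (i : 'I_n.+1) :
  (1 <= K)%N -> strategies K (target i : n.+1.-tuple R).
Proof.
move=> K1; split=> [j|]; rewrite ?tnth_mktuple.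
  by case: eqP => _; rewrite /= ?lexx ?ler01.
under eq_bigr do rewrite tnth_mktuple.
rewrite (bigD1 i) //= eqxx big1 => [|j /negPf ji]; last by rewrite eq_sym ji.
by rewrite addr0 (ler_nat _ 1).
Qed.

(** Full coverage of one target other than the last is feasible as [1 <= K] and makes the coverage
    difference 1, which bounds the weight by [M / 4]. Conversely, coverage differences are at most 1
    in absolute value, and two bounds [M / 4] add up to [M / 2]. *)
Lemma suqr_image n K (M : R) : (0 < n)%N -> (1 <= K)%N -> 0 <= M ->
  suqr M n K = [set suqr_param th | th in box (M / 4)].
Proof.
move=> n0 K1 M0; apply/seteqP; split=> h.
  move=> [_ [w [c [hw hc hE]]]].
  pose th : 'rV[R]_n.+1 := \row_i (if unlift ord_max i is Some j then c j else w).
  exists th.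
    move=> i; rewrite mxE; case: unliftP => [j _|_].
      by rewrite ler_norml hc.
    have := hw (Ordinal n0) _ (target_strategy (lift ord_max (Ordinal n0)) K1).
    rewrite !tnth_mktuple eqxx [lift _ _ == _]eq_sym (negPf (neq_lift _ _)).
    by rewrite subr0 mulr1 ler_norml.
  apply/funext => x; apply: eq_from_tnth => i.
  by rewrite tnth_suqr_param hE !mxE liftK unlift_none.
move=> [th thM <-].
have thw (x : n.+1.-tuple R) (i : 'I_n) : strategies K x ->
    `|th ord0 ord_max * (tnth x (lift ord_max i) - tnth x ord_max)| <= M / 4.
  move=> sx; rewrite normrM -[leRHS]mulr1 ler_pM //.
  exact: strategies_diff_le1 sx.
split.
  move=> x sx i; rewrite -ler_norml tnth_suqr_param.
  apply: (le_trans (ler_normD _ _)).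
  by have := thw x i sx; have := thM (lift ord_max i); lra.
exists (th ord0 ord_max), (fun i => th ord0 (lift ord_max i)); split.
- by move=> i x sx; rewrite -ler_norml; exact: thw.
- by move=> i; rewrite -ler_norml; exact: thM.
- by move=> x i; exact: tnth_suqr_param.
Qed.

Lemma suqr_param_close n K (th th' : 'rV[R]_n.+1) (e : R) x j :
  strategies K x -> (forall i, `|th ord0 i - th' ord0 i| <= e) ->
  `|tnth (suqr_param th x) j - tnth (suqr_param th' x) j| <= 2 * e.
Proof.
move=> sx the; rewrite !tnth_suqr_param.
set u := _ - tnth x _; have u1 : `|u| <= 1 by exact: strategies_diff_le1 sx.
have -> : th ord0 ord_max * u + th ord0 (lift ord_max j) -
    (th' ord0 ord_max * u + th' ord0 (lift ord_max j)) =
    (th ord0 ord_max - th' ord0 ord_max) * u +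
    (th ord0 (lift ord_max j) - th' ord0 (lift ord_max j)) by ring.
apply: (le_trans (ler_normD _ _)).
rewrite (_ : 2 * e = e + e) ?lerD //; last by ring.
by rewrite normrM -[leRHS]mulr1 ler_pM.
Qed.

(** * Lipschitz and centring bounds for the loss *)

Lemma sum_expR_gt0 n (a : n.-tuple R) : 0 < 1 + \sum_(j < n) expR (tnth a j).
Proof. by rewrite ltr_pwDl // sumr_ge0 // => j _; exact: expR_ge0. Qed.

Lemma loss_targetE n (i : 'I_n.+1) (a : n.-tuple R) :
  loss (target i) a = ln (1 + \sum_(j < n) expR (tnth a j)) - score a i.
Proof.
by rewrite loss_target ln_div ?posrE ?expR_gt0 ?sum_expR_gt0 // expRK opprB.
Qed.

(** Raising the scores by [e] multiplies their exponentials by [expR e]; the summand 1 of the last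
    target is covered because [expR e >= 1]. *)
Lemma ln_sum_expR_le n (a b : n.-tuple R) (e : R) : 0 <= e ->
  (forall j, tnth a j <= tnth b j + e) ->
  ln (1 + \sum_(j < n) expR (tnth a j)) <=
  ln (1 + \sum_(j < n) expR (tnth b j)) + e.
Proof.
move=> e0 ab; rewrite -[X in _ <= _ + X]expRK -lnM ?posrE ?expR_gt0 ?sum_expR_gt0 //.
rewrite ler_ln ?posrE ?mulr_gt0 ?expR_gt0 ?sum_expR_gt0 // mulrDl mul1r.
rewrite lerD ?expR_ge1 // -?expR0 ?ler_expR // mulr_suml.
by apply: ler_sum => j _; rewrite -expRD ler_expR.
Qed.

Lemma loss_lipschitz n (i : 'I_n.+1) (a b : n.-tuple R) (e : R) : 0 <= e ->
  (forall j, `|tnth a j - tnth b j| <= e) ->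
  `|loss (target i) a - loss (target i) b| <= 2 * e.
Proof.
move=> e0 ab; rewrite !loss_targetE.
have h1 : forall j, tnth a j <= tnth b j + e.
  by move=> j; have := ab j; rewrite ler_norml; lra.
have h2 : forall j, tnth b j <= tnth a j + e.
  by move=> j; have := ab j; rewrite ler_norml; lra.
have l1 := ln_sum_expR_le e0 h1.
have l2 := ln_sum_expR_le e0 h2.
have : `|score a i - score b i| <= e.
  by rewrite /score; case: unliftP => [j _|_] //; rewrite subrr normr0.
by rewrite !ler_norml; lra.
Qed.

(* The loss of the zero score vector is [ln T]; centring there makes the range
   of the loss independent of T. *)
Lemma loss_center n (i : 'I_n.+1) (a : n.-tuple R) (e : R) : 0 <= e ->
  (forall j, `|tnth a j| <= e) ->
  `|loss (target i) a - ln n.+1%:R| <= 2 * e.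
Proof.
move=> e0 ae.
have -> : ln n.+1%:R = loss (target i) (nseq_tuple n (0 : R)).
  rewrite loss_targetE /score; case: unliftP => [j _|_].
    rewrite tnth_nseq subr0; congr ln.
    under eq_bigr do rewrite tnth_nseq expR0.
    by rewrite sumr_const card_ord -natr1 addrC.
  rewrite subr0; congr ln.
  under eq_bigr do rewrite tnth_nseq expR0.
  by rewrite sumr_const card_ord -natr1 addrC.
by apply: loss_lipschitz => // j; rewrite tnth_nseq subr0.
Qed.

(** Stated for every [y]: the algorithm must also answer on samples outside Z, where empirical risks
    still need a lower bound. *)
Lemma loss_ge0 n (y : n.+1.-tuple R) (a : n.-tuple R) : 0 <= loss y a.
Proof.
rewrite /loss sumr_ge0 // => i _; rewrite oppr_ge0 ln_le0 //.
rewrite ler_pdivrMr ?sum_expR_gt0 // mul1r /score; case: unliftP => [j _|_].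
  by rewrite (bigD1 j) //= addrCA lerDl addr_ge0 // sumr_ge0 //.
by rewrite expR0 lerDl sumr_ge0.
Qed.

(** * Measurability of Z and of the loss *)

Lemma measurable_eq_tuple k (t : k.-tuple R) : measurable [set t].
Proof.
have -> : [set t] = \bigcap_(j in [set: 'I_k])
    (setT `&` (fun u : k.-tuple R => tnth u j) @^-1` [set tnth t j]).
  apply/seteqP; split=> u /=; first by move=> -> j.
  by move=> h; apply: eq_from_tnth => j; have [] := h j I.
apply: fin_bigcap_measurable => [|j _]; first exact: (@finite_finset 'I_k).
by apply: measurable_tnth.
Qed.

Lemma measurable_strategies n K : measurable (@strategies R n K).
Proof.
have -> : @strategies R n K =
    (\bigcap_(j in [set: 'I_n.+1])
      (setT `&` (fun u : n.+1.-tuple R => tnth u j) @^-1` `[0, 1]%classic)) `&`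
    (setT `&` (fun u : n.+1.-tuple R => \sum_(i < n.+1) tnth u i)
      @^-1` `]-oo, K%:R]%classic).
  apply/seteqP; split=> u /=.
    by move=> [h1 h2]; split=> [j _|]; split=> //=; rewrite in_itv //=.
  move=> [h1 [_ h2]]; split; last by move: h2; rewrite in_itv.
  by move=> j; have [_ /=] := h1 j I; rewrite in_itv.
apply: measurableI.
  apply: fin_bigcap_measurable => [|j _]; first exact: (@finite_finset 'I_n.+1).
  by apply: measurable_tnth.
by apply: measurable_sum => // i; exact: measurable_tnth.
Qed.

Lemma measurable_obs_set n K : measurable (@obs_set R n K).
Proof.
apply: measurableX; first exact: measurable_strategies.
have -> : @attacks R n = \bigcup_(i in [set: 'I_n.+1])
    [set (target i : n.+1.-tuple R)].
  by apply/seteqP; split=> [y [i _ <-]|y [i _ ->]]; exists i.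
apply: fin_bigcup_measurable => [|i _]; first exact: (@finite_finset 'I_n.+1).
exact: measurable_eq_tuple.
Qed.

Lemma measurable_loss n (th : 'rV[R]_n.+1) :
  measurable_fun setT (fun z : obs n => loss z.2 (suqr_param th z.1)).
Proof.
have mtn k (g : @obs R n -> k.-tuple R) j : measurable_fun setT g ->
    measurable_fun setT (fun z => tnth (g z) j).
  by move=> mg; exact: measurableT_comp (measurable_tnth j) mg.
have mh (j : 'I_n) : measurable_fun setT
    (fun z : obs n => tnth (suqr_param th z.1) j).
  under eq_fun do rewrite tnth_suqr_param.
  apply: measurable_funD => //; apply: measurable_funM => //.
  by apply: measurable_funB; apply: mtn; exact: measurable_fst.
have -> : (fun z : obs n => loss z.2 (suqr_param th z.1)) = fun z : obs n =>
    \sum_(i < n.+1) if z.2 == target i then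
      ln (1 + \sum_(j < n) expR (tnth (suqr_param th z.1) j))
      - score (suqr_param th z.1) i else 0.
  apply/funext => z; rewrite /loss big_mkcond; apply: eq_bigr => i _.
  by case: ifP => // _; rewrite -loss_target loss_targetE.
apply: measurable_sum => i; apply: measurable_fun_ifT => //.
  apply: (measurable_fun_bool true).
  have -> : (fun z : obs n => z.2 == target i) @^-1` [set true] =
      setT `&` snd @^-1` [set target i : n.+1.-tuple R].
    by apply/seteqP; split=> z /=; [move=> /eqP|move=> [_ ->]; exact: eqxx].
  rewrite setTI; apply: measurable_snd => //; exact: measurable_eq_tuple.
apply: measurable_funB.
  apply: measurableT_comp => //; apply: measurable_funD => //.
  by apply: measurable_sum => j; exact: measurableT_comp (mh j).
by rewrite /score; case: unliftP.
Qed.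

End Suqr.

(** * Nets of the parameter box *)

Section Net.
Context {R : realType}.
Variables (k : nat) (r : R).
Hypothesis r_gt0 : 0 < r.

Definition net_step (N : nat) : R := 2 * r / N.+1%:R.

(** Both endpoints of [[- r, r]] are grid values, so [N.+1] steps give [N.+2] values per
    coordinate. *)
Definition net (N : nat) (b : {ffun 'I_k -> 'I_N.+2}) : 'rV[R]_k :=
  \row_i ((b i)%:R * net_step N - r).

Lemma net_step_gt0 N : 0 < net_step N.
Proof. by rewrite divr_gt0 ?mulr_gt0. Qed.

Lemma net_stepE N : N.+1%:R * net_step N = 2 * r.
Proof. by rewrite /net_step mulrCA divff ?mulr1. Qed.

Lemma net_box N (b : {ffun 'I_k -> 'I_N.+2}) : box r (net b).
Proof.
move=> i; rewrite mxE ler_norml.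
have : (b i)%:R * net_step N <= 2 * r.
  by rewrite -(net_stepE N) ler_pM2r ?net_step_gt0 // ler_nat -ltnS.
have : 0 <= (b i)%:R * net_step N by rewrite mulr_ge0 // ltW // net_step_gt0.
lra.
Qed.

Lemma net_cover N (th : 'rV[R]_k) : box r th ->
  exists b : {ffun 'I_k -> 'I_N.+2},
    forall i, `|th ord0 i - net b ord0 i| <= net_step N.
Proof.
move=> thr; have s0 := net_step_gt0 N.
pose y i := (th ord0 i + r) / net_step N.
have y0 i : 0 <= y i.
  by rewrite divr_ge0 ?(ltW s0) //; have := thr i; rewrite ler_norml; lra.
have yN i : (Num.truncn (y i) < N.+2)%N.
  rewrite truncn_lt_nat // ltr_pdivrMr // -natr1 mulrDl net_stepE mul1r.
  by have := thr i; rewrite ler_norml; lra.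
exists [ffun i => Ordinal (yN i)] => i; rewrite mxE ffunE /=.
have := truncn_itv (y0 i).
rewrite ler_pdivlMr // ltr_pdivrMr // -natr1 mulrDl mul1r ler_norml.
by move: (_%:R * _) => u; lra.
Qed.

Lemma box_compact : compact (@box R k r).
Proof.
have -> : @box R k r = [set v | forall i, `[- r, r]%classic (v ord0 i)].
  by apply/seteqP; split=> v h i; have := h i; rewrite /= in_itv /= ler_norml.
apply: (@rV_compact _ _ (fun=> `[- r, r]%classic)) => _.
exact: segment_compact.
Qed.

Lemma entrywise_lipschitz_continuous (f : 'rV[R]_k -> R) (L : R) :
  (forall (th th' : 'rV[R]_k) (e : R), 0 <= e ->
    (forall i, `|th ord0 i - th' ord0 i| <= e) ->
    `|f th - f th'| <= L * e) ->
  continuous f.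
Proof.
move=> fL th.
apply/(cvgrPdist_le (FF := nbhs_filter (th : 'rV[R]_k))) => e e0.
(* This divisor is positive for every sign of [L]. *)
have L1 : 0 < `|L| + 1 by rewrite ltr_wpDl.
have d0 : 0 < e / (`|L| + 1) by rewrite divr_gt0.
near=> th'.
have [_ hb] : ball th (e / (`|L| + 1)) th' by near: th'; exact: nbhsx_ballx.
have := fL th th' _ (ltW d0) (fun i => ltW (hb ord0 i)).
move=> /le_trans; apply; rewrite mulrA ler_pdivrMr // mulrC ler_pM2l //.
by rewrite (le_trans (ler_norm L)) // lerDl.
Unshelve. all: by end_near. Qed.

(* A continuous function on the box attains its supremum, so the strict bound
   on the box is a strict bound with some room to spare, which can be tested on
   a fine enough net. *)
Lemma measurable_box_event d (Omega : measurableType d)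
    (D : Omega -> 'rV[R]_k -> R) (L a : R) :
  0 <= L -> (forall th, measurable_fun setT (D ^~ th)) ->
  (forall w (th th' : 'rV[R]_k) (e : R), 0 <= e ->
    (forall i, `|th ord0 i - th' ord0 i| <= e) ->
    `|D w th - D w th'| <= L * e) ->
  measurable [set w | forall th, box r th -> `|D w th| < a].
Proof.
move=> L0 mD DL.
(* The uncountable intersection over the box becomes a countable union, over the fineness of the
   net, of finite intersections. *)
have -> : [set w | forall th, box r th -> `|D w th| < a] =
    \bigcup_N \bigcap_(b in [set: {ffun 'I_k -> 'I_N.+2}])
      (setT `&` (fun w => `|D w (net b)|)
        @^-1` `]-oo, a - L * net_step N[%classic).
  apply/seteqP; split=> w /=; last first.
    move=> [N _ h] th /(net_cover N)[b hb].
    have [_ /=] := h b I; rewrite in_itv /=.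
    have := DL w _ _ _ (ltW (net_step_gt0 N)) hb.
    have := ler_normD (D w th - D w (net b)) (D w (net b)).
    by rewrite subrK; lra.
  move=> h.
  have box0 : @box R k r !=set0 by exists 0 => i; rewrite mxE normr0 ltW.
  have cD : {within @box R k r, continuous (fun th => `|D w th|)}.
    apply: continuous_subspaceT => th.
    apply: (continuous_comp (g := fun x : R => `|x|)); last exact: norm_continuous.
    exact: entrywise_lipschitz_continuous (DL w) th.
  have [th0 /set_mem th0r th0max] := EVT_max_rV box0 box_compact cD.
  have gap : 0 < a - `|D w th0| by rewrite subr_gt0; exact: h.
  (* Fine enough for [L * net_step N] to fall below the gap between the maximum and [a]. *)
  exists (Num.truncn (L * (2 * r) / (a - `|D w th0|))) => // b _; split=> //=.
  rewrite in_itv /=; set N := Num.truncn _.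
  have : L * net_step N < a - `|D w th0|.
    rewrite /net_step mulrA ltr_pdivrMr // [ltRHS]mulrC -ltr_pdivrMr //.
    exact: truncnS_gt.
  have := th0max _ (mem_set (net_box b)).
  by rewrite /=; lra.
apply: bigcupT_measurable => N; apply: fin_bigcap_measurable => [|b _].
  exact: finite_finset.
have mDb : measurable_fun setT (fun w => `|D w (net b)|).
  by apply: measurableT_comp => //; exact: mD.
exact: mDb.
Qed.

End Net.

(** * Uniform convergence *)

Section Deviation.
Context {R : realType}.
Variables (n K : nat).

Lemma loss_param_close (th th' : 'rV[R]_n.+1) (e : R) (z : obs n) : 0 <= e ->
  (forall i, `|th ord0 i - th' ord0 i| <= e) -> obs_set K z ->
  `|loss z.2 (suqr_param th z.1) - loss z.2 (suqr_param th' z.1)| <= 4 * e.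
Proof.
move=> e0 the [sz [i _ <-]].
rewrite (_ : 4 * e = 2 * (2 * e)); last by ring.
apply: loss_lipschitz => [|j]; first by rewrite mulr_ge0.
exact: suqr_param_close sz the.
Qed.

Lemma loss_param_center (th : 'rV[R]_n.+1) (e : R) (z : obs n) : 0 <= e ->
  box e th -> obs_set K z ->
  `|loss z.2 (suqr_param th z.1) - ln n.+1%:R| <= 4 * e.
Proof.
move=> e0 the [sz [i _ <-]].
rewrite (_ : 4 * e = 2 * (2 * e)); last by ring.
apply: loss_center => [|j]; first by rewrite mulr_ge0.
(* The zero parameter has zero scores, so closeness to it bounds the scores by [2 * e]. *)
have h0 i' : `|th ord0 i' - (0 : 'rV[R]_n.+1) ord0 i'| <= e.
  by rewrite mxE subr0; exact: the.
have := suqr_param_close j sz h0.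
by rewrite [tnth (suqr_param 0 _) _]tnth_suqr_param !mxE mul0r addr0 subr0.
Qed.

Variable p : probability (@obs R n) R.
Hypothesis pK : p (obs_set K) = 1%E.

Lemma risk_param (th : 'rV[R]_n.+1) : risk p (suqr_param th) =
  \int[p]_(z in obs_set K) loss z.2 (suqr_param th z.1).
Proof.
rewrite /risk; apply: expectation_on_full_set => //.
- exact: measurable_obs_set.
- exact: measurable_loss.
Qed.

Lemma integrable_loss_param (th : 'rV[R]_n.+1) : p.-integrable (obs_set K)
  (EFin \o (fun z : obs n => loss z.2 (suqr_param th z.1))).
Proof.
(* Any parameter lies in the box of this radius, so its loss is bounded on Z. *)
pose e := \sum_i `|th ord0 i|.
have the : box e th by move=> i; rewrite /e (bigD1 i) //= lerDl sumr_ge0.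
have e0 : 0 <= e by exact: sumr_ge0.
apply: (measurable_bounded_on_integrable (@measurable_obs_set R n K) pK
  (W := `|ln n.+1%:R| + 4 * e)).
  by apply: measurable_funTS; exact: measurable_loss.
move=> z /(loss_param_center e0 the) h.
rewrite -[loss _ _](subrK (ln n.+1%:R)) addrC.
by apply: (le_trans (ler_normD _ _)); rewrite lerD2l.
Qed.

Definition deviation (m : nat) (s : m.-tuple (@obs R n)) (th : 'rV[R]_n.+1) : R :=
  empirical_risk s (suqr_param th) - risk p (suqr_param th).

(** The empirical risk and the risk average the same loss, so each contributes [4 * e]. *)
Lemma deviation_lipschitz (m : nat) (s : m.-tuple (@obs R n))
    (th th' : 'rV[R]_n.+1) (e : R) : (0 < m)%N ->
  (forall i, obs_set K (tnth s i)) -> 0 <= e ->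
  (forall i, `|th ord0 i - th' ord0 i| <= e) ->
  `|deviation s th - deviation s th'| <= 8 * e.
Proof.
move=> m0 sK e0 the; rewrite /deviation.
have hr : `|risk p (suqr_param th) - risk p (suqr_param th')| <= 4 * e.
  rewrite !risk_param; apply: Rintegral_close => //.
  - exact: measurable_obs_set.
  - exact: integrable_loss_param.
  - exact: integrable_loss_param.
  - by move=> z; exact: loss_param_close.
have he : `|empirical_risk s (suqr_param th) - empirical_risk s (suqr_param th')|
    <= 4 * e.
  rewrite /empirical_risk -mulrBr -sumrB normrM ger0_norm ?invr_ge0 //.
  rewrite mulrC ler_pdivrMr ?ltr0n //.
  apply: (le_trans (ler_norm_sum _ _ _)).
  rewrite mulr_natr -[X in _ *+ X](card_ord m) -sumr_const.
  by apply: ler_sum => i _; exact: loss_param_close.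
have -> : forall a b c d : R, a - b - (c - d) = (a - c) - (b - d).
  by move=> *; ring.
by apply: (le_trans (ler_normB _ _)); lra.
Qed.

Context d (Omega : measurableType d) (P : probability Omega R) (m : nat).
Variable z : Omega -> m.-tuple (@obs R n).
Hypothesis zK : forall w i, obs_set K (tnth (z w) i).
Hypothesis z_iid : iid_draws P p z.

Lemma measurable_draw i : measurable_fun setT (fun w => tnth (z w) i).
Proof. by have [mz _ _] := z_iid; exact: measurableT_comp (measurable_tnth i) mz. Qed.

Lemma measurable_deviation th : measurable_fun setT (fun w => deviation (z w) th).
Proof.
apply: measurable_funB => //; apply: measurable_funM => //.
apply: measurable_sum => i.
exact: (measurableT_comp (measurable_loss th) (measurable_draw i)).
Qed.

Lemma deviation_tail (th : 'rV[R]_n.+1) (W t : R) : (0 < m)%N -> 0 < W ->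
  box (W / 4) th -> 0 < t <= 8 * W ->
  let E := [set w | t <= `|deviation (z w) th|] in
  measurable E /\
  (P E <= (2 * expR (- (m%:R * t ^+ 2 / (128 * W ^+ 2))))%:E)%E.
Proof.
move=> m0 W0 thW tW; rewrite /deviation risk_param.
apply: (hoeffding (@measurable_obs_set R n K) pK (fun i w => zK w i)
  measurable_draw _ m0 (measurable_loss th) _ W0 tW (c := ln n.+1%:R)).
- move=> B mB; have [_ law indep] := z_iid.
  (* Mutual independence is applied to the set of all indices. *)
  transitivity (P [set w | forall i, i \in [set: 'I_m]%SET -> B i (tnth (z w) i)]).
    by congr (P _); apply/seteqP; split=> w h i => [_|]; apply: h; rewrite ?inE.
  rewrite (indep _ _ mB); apply: eq_big => [i|i _]; first by rewrite inE.
  exact: law.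
- move=> s sK; rewrite (_ : W = 4 * (W / 4)); last by field.
  by apply: loss_param_center => //; rewrite divr_ge0 // ltW.
Qed.

(** Half of [a] is spent on the passage to the nearest grid point; the other half is the level of
    the tail bound in the union over the [N.+2 ^ n.+1] grid points. *)
Lemma uniform_deviation (W a : R) (N : nat) : (0 < m)%N -> 0 < W ->
  0 < a <= 16 * W ->
  8 * net_step (W / 4) N <= a / 2 ->
  let E := [set w | forall th, box (W / 4) th -> `|deviation (z w) th| < a] in
  measurable E /\
  (P (~` E) <= (N.+2%:R ^+ n.+1 *
     (2 * expR (- (m%:R * (a / 2) ^+ 2 / (128 * W ^+ 2)))))%:E)%E.
Proof.
move=> m0 W0 aW Na E.
have W40 : 0 < W / 4 by rewrite divr_gt0.
have mE : measurable E.
  apply: (measurable_box_event W40 (L := 8)) => //.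
    exact: measurable_deviation.
  by move=> w th th' e e0 the; exact: deviation_lipschitz.
split=> //.
have ta : 0 < a / 2 <= 8 * W by lra.
pose F (b : {ffun 'I_n.+1 -> 'I_N.+2}) :=
  [set w | a / 2 <= `|deviation (z w) (net (W / 4) b)|].
have FP (b : {ffun 'I_n.+1 -> 'I_N.+2}) := deviation_tail m0 W0 (net_box W40 b) ta.
apply: (@le_trans _ _ (\sum_(b : {ffun 'I_n.+1 -> 'I_N.+2}) P (F b))%E).
  apply: measure_le_sum.
  - by move=> b _; have [] := FP b.
  - exact: measurableC.
  move=> w nEw; apply: contrapT => nF; apply: nEw => th thW.
  have [b hb] := net_cover W40 N thW.
  have : `|deviation (z w) (net (W / 4) b)| < a / 2.
    by rewrite ltNge; apply/negP => Fb; apply: nF; exists b.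
  have := deviation_lipschitz m0 (zK w) (ltW (net_step_gt0 W40 N)) hb.
  have := ler_normD (deviation (z w) th - deviation (z w) (net (W / 4) b))
                    (deviation (z w) (net (W / 4) b)).
  by rewrite subrK; lra.
set q := 2 * _.
apply: (@le_trans _ _ (\sum_(b : {ffun 'I_n.+1 -> 'I_N.+2}) q%:E)%E).
  by apply: lee_sum => b _; have [] := FP b.
rewrite sumEFin sumr_const card_ffun !card_ord lee_fin -natrX mulr_natl.
by [].
Qed.

End Deviation.

(* A grid of more than [24 M / alpha] steps costs [alpha / 6], and the deviation
   on the grid is kept below [alpha / 6], whence the factor [36]. The summand
   [ln (26 M) / ln 2] is the least [k] with [ln (26 M) <= k ln 2]; then
   [ln (26 M / alpha) <= k ln (T / alpha)], as [T >= 2]. *)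
Lemma net_union_bound (R : realType) (M alpha delta : R) (T m : nat) :
  1 < M -> (2 <= T)%N -> 0 < alpha < 1 -> 0 < delta < 1 ->
  128 * 36 * M ^+ 2 * (2 + ln (26 * M) / ln 2) / alpha ^+ 2 *
    (ln (1 / delta) + T%:R * ln (T%:R / alpha)) <= m%:R ->
  (Num.truncn (24 * M / alpha)).+2%:R ^+ T *
    (2 * expR (- (m%:R * (alpha / 3 / 2) ^+ 2 / (128 * M ^+ 2)))) < delta / 2.
Proof.
move=> M1 T2 /andP[a0 a1] /andP[d0 d1] hm.
have T2R : 2 <= T%:R :> R by rewrite (ler_nat _ 2).
have T0 : 0 < T%:R :> R by lra.
have M0 : 0 < M by lra.
have M20 : 0 < M ^+ 2 by rewrite exprn_gt0.
have a20 : 0 < alpha ^+ 2 by rewrite exprn_gt0.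
have ln20 : 0 < ln 2 :> R by rewrite ln_gt0 ?ltr1n.
(* The two extra points cost at most [2 * M / alpha], since [M / alpha >= 1]. *)
have N26 : (Num.truncn (24 * M / alpha)).+2%:R <= 26 * M / alpha.
  have h24 : 0 <= 24 * M / alpha by rewrite divr_ge0 ?mulr_ge0 ?ltW.
  have /andP[h _] := truncn_itv h24.
  have h1 : 1 <= M / alpha by rewrite ler_pdivlMr //; lra.
  rewrite -2!natr1 -mulrA; rewrite -mulrA in h.
  by move: h; set t := _%:R; lra.
have q0 : 0 < 26 * M / alpha by rewrite divr_gt0 ?mulr_gt0.
set kap := ln (26 * M) / ln 2 in hm.
have kapE : ln (26 * M) = kap * ln 2 by rewrite /kap mulfVK ?gt_eqF.
have kap1 : 1 <= kap.
  by rewrite /kap ler_pdivlMr // mul1r ler_ln ?posrE ?mulr_gt0 //; lra.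
have dd : ln (1 / delta) = - ln delta.
  by rewrite ln_div ?posrE // ln1 sub0r.
have dneg : ln delta < 0 by rewrite -ln1 ltr_ln ?posrE.
have aneg : ln alpha < 0 by rewrite -ln1 ltr_ln ?posrE.
have TE : ln (T%:R / alpha) = ln T%:R - ln alpha by rewrite ln_div ?posrE.
have lnT : ln 2 <= ln T%:R :> R by rewrite ler_ln ?posrE.
set b := ln (T%:R / alpha) in hm TE.
have b2 : ln 2 <= b by lra.
have qb : ln (26 * M / alpha) <= kap * b.
  rewrite ln_div ?posrE ?mulr_gt0 // kapE TE.
  rewrite -subr_ge0 (_ : _ - _ = kap * (ln T%:R - ln 2) + (kap - 1) * - ln alpha).
    by apply: addr_ge0; apply: mulr_ge0; lra.
  by ring.
have exponent : (2 + kap) * (ln (1 / delta) + T%:R * b) <=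
    m%:R * (alpha / 3 / 2) ^+ 2 / (128 * M ^+ 2).
  rewrite ler_pdivlMr ?mulr_gt0 //.
  have := ler_wpM2r (ltW a20) hm.
  rewrite mulrAC divfK ?gt_eqF // => h.
  rewrite (_ : (alpha / 3 / 2) ^+ 2 = alpha ^+ 2 / 36); last by field.
  rewrite mulrA ler_pdivlMr //; apply: le_trans h.
  rewrite le_eqVlt; apply/orP; left; apply/eqP; ring.
have -> : delta / 2 = expR (ln delta - ln 2).
  by rewrite expRB !lnK ?posrE.
have {1}-> : 2 = expR (ln 2) :> R by rewrite lnK ?posrE.
apply: (@le_lt_trans _ _ (expR (T%:R * ln (26 * M / alpha)) *
   (expR (ln 2) * expR (- ((2 + kap) * (ln (1 / delta) + T%:R * b)))))).
  apply: ler_pM => //.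
  - by rewrite expRM_natl lnK ?posrE // lerXn2r ?nnegrE // ltW.
  - by rewrite ler_pM2l ?expR_gt0 // ler_expR lerN2.
(* In the exponent [kap * (T%:R * b)] pays for the grid and [2 * (T%:R * b)] for two factors 2, from
   the two tails and from [delta / 2]; negativity of [ln delta] makes the inequality strict. *)
rewrite -!expRD ltr_expR dd.
have h1 : T%:R * ln (26 * M / alpha) <= kap * (T%:R * b).
  by rewrite mulrCA ler_pM2l.
have h2 : 2 * ln 2 <= T%:R * b by rewrite ler_pM // ltW.
have h3 : ln delta * kap <= ln delta by rewrite ger_nMr.
have -> : (2 + kap) * (- ln delta + T%:R * b) =
    2 * (T%:R * b) + kap * (T%:R * b) - 2 * ln delta - ln delta * kap by ring.
lra.
Qed.

(** Empirical risks are nonnegative and the class contains the zero parameter, so the infimum is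
    genuine and can be approached within [a]. *)
Lemma suqr_approx_erm (R : realType) (n K m : nat) (M a : R) : 0 <= M -> 0 < a ->
  (0 < n)%N -> (1 <= K)%N -> forall s : m.-tuple (@obs R n),
  exists h, suqr M n K h /\
    `|empirical_risk s h - inf [set empirical_risk s g | g in suqr M n K]| < a.
Proof.
move=> M0 a0 n0 K1 s; set S := [set _ | _ in _].
have S0 : has_inf S.
  split; last first.
    exists 0 => _ [g _ <-]; rewrite mulr_ge0 ?invr_ge0 // sumr_ge0 // => i _.
    exact: loss_ge0.
  exists (empirical_risk s (suqr_param (0 : 'rV[R]_n.+1))).
  exists (suqr_param 0) => //; rewrite suqr_image //; exists 0 => // i.
  by rewrite mxE normr0 divr_ge0.
have [_ [h hH <-] hinf] := inf_adherent a0 S0.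
exists h; split=> //.
have hge : inf S <= empirical_risk s h by apply: ge_inf; [case: S0 | exists h].
by rewrite ger0_norm ?subr_ge0 // ltrBlDl.
Qed.

Theorem theorem2 (R : realType) (M : R) (hM : 1 < M) :
  exists C : R, 0 < C /\
    forall (n K : nat) (alpha delta : R) (m : nat),
      (2 <= n.+1)%N -> (1 <= K < n.+1)%N ->
      0 < alpha < 1 -> 0 < delta < 1 ->
      C / alpha ^+ 2 *
        (ln (1 / delta) + n.+1%:R * ln (n.+1%:R / alpha)) <= m%:R ->
      PAC_learnable K (suqr M n K) alpha delta m.
Proof.
have M0 : 0 < M by lra.
have lnM : 0 < ln (26 * M) / ln 2 by rewrite divr_gt0 ?ln_gt0 //; lra.
have C0 : 0 < 128 * 36 * M ^+ 2 * (2 + ln (26 * M) / ln 2).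
  by rewrite !mulr_gt0 ?addr_gt0 ?exprn_gt0.
exists (128 * 36 * M ^+ 2 * (2 + ln (26 * M) / ln 2)); split => //.
move=> n K alpha delta m n2 /andP[K1 _] ha hd hm.
have /andP[a0 a1] := ha; have /andP[d0 d1] := hd.
have m0 : (0 < m)%N.
  rewrite -(ltr0n R); apply: lt_le_trans hm.
  rewrite mulr_gt0 ?divr_gt0 ?exprn_gt0 // addr_gt0 //.
    by rewrite ln_gt0 // mul1r invf_gt1.
  rewrite mulr_gt0 // ln_gt0 // ltr_pdivlMr // mul1r.
  by apply: (lt_le_trans a1); rewrite ler1n.
have a30 : 0 < alpha / 3 by rewrite divr_gt0.
(* Choosing an approximate minimiser for each sample fixes the algorithm before the distribution is
   given. *)
have /choice[A hA] := suqr_approx_erm (m := m) (ltW M0) a30 n2 K1.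
exists A; split=> [s|p pK d Omega P z zK ziid]; first by have [] := hA s.
split; last first.
  have -> : [set w | `|empirical_risk (z w) (A (z w)) -
      inf [set empirical_risk (z w) h | h in suqr M n K]| < alpha / 3] = setT.
    by apply/seteqP; split=> w //= _; have [] := hA (z w).
  by split; rewrite ?probability_setT ?lte_fin; [exact: measurableT | lra].
pose N := Num.truncn (24 * M / alpha).
(* The left-hand side is [4 * M / N.+1%:R], so the bound [alpha / 6] amounts to
   [24 * M / alpha <= N.+1%:R]. *)
have step : 8 * net_step (M / 4) N <= alpha / 3 / 2.
  have : 24 * M / alpha <= N.+1%:R by apply: ltW; exact: truncnS_gt.
  rewrite ler_pdivrMr // => h.
  rewrite /net_step mulrA ler_pdivrMr //.
  by move: h; move: N.+1%:R => v; lra.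
have aM : 0 < alpha / 3 <= 16 * M by lra.
have [mE PE] := uniform_deviation pK zK ziid m0 M0 aM step.
have bnd := net_union_bound hM n2 ha hd hm.
set E := [set w | _] in mE PE.
have -> : [set w | forall h, suqr M n K h ->
    `|empirical_risk (z w) h - risk p h| < alpha / 3] = E.
  rewrite suqr_image ?(ltW M0) //; apply/seteqP; split=> w /= Ew.
    by move=> th thM; apply: Ew; exists th.
  by move=> _ [th thM <-]; exact: Ew.
split=> //.
have PEC : (P (~` E) < (delta / 2)%:E)%E.
  by apply: (le_lt_trans PE); rewrite lte_fin.
rewrite -[E]setCK probability_setC; last exact: measurableC.
have fin : P (~` E) \is a fin_num by apply: fin_num_measure; exact: measurableC.
rewrite -(fineK fin) -EFinB lte_fin ltrD2l ltrN2.
by rewrite -lte_fin fineK.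
Qed.
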